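(* Let $A:U_\infty\to\mathcal M^{n\times n}_{\rm sym}$ and $b:U_\infty\to\mathbb R^n$ be given functions, and assume there are constants $c_0>0$ and $M_1>0$ such that $\xi^{\rm T}A(x,t)\xi\ge c_0|\xi|^2$ and ${\rm Tr}(A(x,t))\le M_1$ for all $(x,t)\in U_\infty$, $\xi\in\mathbb R^n$. Let $w\in C(\overline{U_\infty})\cap C^{2,1}_{x,t}(U_\infty)$. Assume there is $T^*\ge0$ such that the following hold. (1) There is $F\in C([T^*,\infty),[0,\infty))$ such that $|\widetilde Lw(x,t)|\le F(t)$ for all $(x,t)\in U\times(T^*,\infty)$. (2) There is a continuous function $z_0(t)>0$ on $[T^*,\infty)$, increasing to infinity as $t\to\infty$, such that $|b(x,t)|\le z_0(t)$ for all $(x,t)\in U\times(T^*,\infty)$. (3) There is a decreasing, continuous function $\Lambda_*(t)\ge0$ on $[T^*,\infty)$ such that $$\max_{(x,\tau)\in\Gamma\times[t,t+1]}|w(x,\tau)|+\int_t^{t+1}F(\tau)\,{\rm d}\tau\le\Lambda_*(t)\quad\text{for all }t\ge T^*.$$ Define $\bar\Lambda(t)=\Lambda_*(t/4)$ for $t\ge4T^*$, and assume further: (4) $\displaystyle\int_{T^*}^\infty e^{-\frac{d}{c_0}z_0(x)}\,{\rm d}x=\infty$. (5) There are numbers $t_*\ge4T^*$ and $\varepsilon_*>0$ such that, for any $\varepsilon\in(0,\varepsilon_* )$, the function $$t\in[t_*,\infty)\mapsto\bar\Lambda(t)\exp\left(e^{-\frac{d^2}{2c_0}-\varepsilon}\int_{t_*}^{t+1}e^{-\frac{d}{c_0}z_0(x)}\,{\rm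 d}x\right)$$ is monotone. (6) $\displaystyle\limsup_{t\to\infty}\left(\bar\Lambda(t)e^{\frac{d}{c_0}z_0(t)}\right)=\ell\in[0,\infty)$. Then $$\limsup_{t\to\infty}\left(\max_{x\in\bar U}|w(x,t)|\right)\le e^{\frac{d^2}{2c_0}}\ell.$$
   Context: $n\ge1$ is fixed; $U$ is a non-empty, open, bounded subset of $\mathbb R^n$ with boundary $\Gamma$, closure $\bar U$ and diameter $d=\max\{|x-x'|:x,x'\in\bar U\}$. $U_\infty=U\times(0,\infty)$, $\overline{U_\infty}=\bar U\times[0,\infty)$. $\mathcal M^{n\times n}_{\rm sym}$ is the set of real symmetric $n\times n$ matrices. $C^{2,1}_{x,t}(U\times I)$, for an interval $I$, is the class of continuous functions on $U\times I$ with continuous partial derivatives $\partial u/\partial t$, $\partial u/\partial x_i$, $\partial^2u/\partial x_i\partial x_j$. $\langle A,B\rangle={\rm Tr}(A^{\rm T}B)$; $D^2w$, $\nabla w$ are the Hessian and gradient in $x$. $\widetilde Lw=w_t-\langle A(x,t),D^2w\rangle+b(x,t)\cdot\nabla w$. ''Increasing'', ''decreasing'' and ''monotone'' are in the non-strict sense. *)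

(* Defs.v *)
From HB Require Import structures.
From mathcomp Require Export all_boot all_order all_algebra.
From mathcomp Require Export all_classical all_reals all_analysis.
Export Order.TTheory GRing.Theory Num.Theory.
Export numFieldNormedType.Exports.

Set Implicit Arguments.
Unset Strict Implicit.
Unset Printing Implicit Defensive.

Local Open Scope classical_set_scope.
Local Open Scope ring_scope.

(* Functions on a subset of R^n x R are modelled by total curried functions
   'rV[R]_n -> R -> _; their values outside the subset are irrelevant. *)

Section Euclidean.
Context {R : realType} {n : nat}.
Implicit Types (x y : 'rV[R]_n) (U : set 'rV[R]_n).

Definition dotp x y : R := \sum_(i < n) x 0 i * y 0 i.

(* The library norm on 'rV[R]_n is the sup norm, which induces the same
   topology and the same bounded sets but not the same distances. *)
Definition enorm x : R := Num.sqrt (dotp x x).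

Definition boundary U : set 'rV[R]_n := closure U `\` interior U.

(* For nonempty bounded U, this supremum is attained, as closure U is compact;
   the same holds wherever sup renders the maximum of a continuous function
   over a nonempty compact set. *)
Definition diameter U : R :=
  sup [set enorm (x - y) | x in closure U & y in closure U].

End Euclidean.

Section Differential.
Context {R : realType} {n : nat}.
Implicit Types (u w : 'rV[R]_n -> R -> R) (x : 'rV[R]_n) (t : R).

Definition ebase (i : 'I_n) : 'rV[R]_n := delta_mx 0 i.

Definition dx (i : 'I_n) u : 'rV[R]_n -> R -> R :=
  fun x t => 'D_(ebase i) (fun y => u y t) x.

Definition dt u : 'rV[R]_n -> R -> R := fun x t => derive1 (u x) t.

Definition grad u x t : 'rV[R]_n := \row_i dx i u x t.

Definition hess u x t : 'M[R]_n := \matrix_(i, j) dx i (dx j u) x t.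

Definition mxinner (A B : 'M[R]_n) : R := \tr (A^T *m B).

Definition Lop (A : 'rV[R]_n -> R -> 'M[R]_n) (b : 'rV[R]_n -> R -> 'rV[R]_n)
    w : 'rV[R]_n -> R -> R :=
  fun x t => dt w x t - mxinner (A x t) (hess w x t)
             + dotp (b x t) (grad w x t).

Definition cont_on (D : set ('rV[R]_n * R)) u : Prop :=
  {within D, continuous (fun p : 'rV[R]_n * R => u p.1 p.2)}.

(* Meant for U and I open, so that all derivatives at the points of U `*` I
   are two-sided and determined by the values of u on U `*` I. *)
Definition C21 (U : set 'rV[R]_n) (I : set R) u : Prop :=
  [/\ cont_on (U `*` I) u,
      (forall x t, U x -> I t -> derivable (u x) t 1) /\
        cont_on (U `*` I) (dt u),
      forall i : 'I_n,
        (forall x t, U x -> I t -> derivable (fun y => u y t) x (ebase i)) /\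
        cont_on (U `*` I) (dx i u)
    & forall i j : 'I_n,
        (forall x t, U x -> I t ->
           derivable (fun y => dx j u y t) x (ebase i)) /\
        cont_on (U `*` I) (dx i (dx j u))].

End Differential.

Section Monotone.
Context {R : realType}.
Implicit Types (D : set R) (f : R -> R).

Definition increasing_on D f : Prop :=
  forall s t, D s -> D t -> s <= t -> f s <= f t.

Definition decreasing_on D f : Prop :=
  forall s t, D s -> D t -> s <= t -> f t <= f s.

Definition monotone_on D f : Prop := increasing_on D f \/ decreasing_on D f.

End Monotone.

(* Main.v *)
Require Import Defs.
From mathcomp Require Import ring lra.

(* A bound |w(.,s)| <= J h on U, with a weight h in [1/2, 1] depending on one
   coordinate only, improves over one unit of time.  Let U lie in the slab
   c - d <= x_0 <= c and let z = z_0(s+1) bound the drift on [s, s+1].  The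
   weight h = 1 - e^{mu (x_0 - c)}/2, with mu = z/c_0 + 1, satisfies
   L h >= kappa := (z + c_0) e^{-d} e^{-(d/c_0) z} / 2, so comparison with
   (J (1 - theta (t-s)) + const + 2 \int_s^t F) h, for 2 theta <= kappa, gives
     |w(.,s+1)| <= (J (1 - theta) + 2 Lambda(s)) h.
   Since h increases with mu, hence with s, these steps chain without loss.
   Put q = e^{-(d/c_0) z}.  As z_0 tends to infinity, theta = N q is admissible
   for every fixed N once s is large, whereas Lambda(s) = Lambdabar(4s) <= (l+1) q
   because 4s >= s+1.  The recursion J' <= (1 - N q) J + 2 (l+1) q, together with
   the divergence of the sum of q, drives J below 4 (l+1)/N; as N is arbitrary,
   max |w| tends to 0, which is stronger than the asserted bound. *)

Set Implicit Arguments.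
Unset Strict Implicit.
Unset Printing Implicit Defensive.

Local Open Scope classical_set_scope.
Local Open Scope ring_scope.

(** * Linear algebra: the trace of a product of semidefinite matrices *)

(** The two cross terms coincide because [A] is symmetric. A suitable choice of [c] then turns
    semidefiniteness into information on single entries of [A]. *)
Lemma quadform_add_delta (R : realFieldType) (n : nat) (A : 'M[R]_n)
    (xi : 'rV[R]_n) (i : 'I_n) (c : R) : A^T = A ->
  let eta := xi + c *: delta_mx 0 i in
  (eta *m A *m eta^T) 0 0 = (xi *m A *m xi^T) 0 0
    + 2 * c * (xi *m A) 0 i + c ^+ 2 * A i i.
Proof.
move=> Asym /=.
rewrite linearD/= linearZ/= trmx_delta !mulmxDl !mulmxDr -!scalemxAl.
rewrite -!scalemxAr -!rowE -!colE.
have -> : row i A *m xi^T = (xi *m A *m delta_mx i 0)^T.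
  by rewrite !trmx_mul Asym trmx_delta mulmxA -rowE.
rewrite -colE; move: (xi *m A) (xi *m A *m xi^T) => p q; rewrite !mxE; ring.
Qed.

(** Elimination replaces a spectral decomposition. As long as some diagonal entry is nonzero, [A] is
    a positive semidefinite remainder plus a rank one matrix [a^-1 r^T r], whose contribution to the
    trace is [a^-1 r H r^T <= 0]. The induction is on the number of nonzero diagonal entries. *)
Lemma mxtrace_sym_psd_le0 (R : realFieldType) (n : nat) (A H : 'M[R]_n) :
  A^T = A ->
  (forall xi : 'rV_n, 0 <= (xi *m A *m xi^T) 0 0) ->
  (forall xi : 'rV_n, (xi *m H *m xi^T) 0 0 <= 0) ->
  \tr (A *m H) <= 0.
Proof.
move=> + + Hn.
have [m] := ubnP #|[pred i | A i i != 0]|; elim: m A => //.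
move=> m IH A /ltnSE Am Asym A0.
have diagE B i : (delta_mx 0 i *m B *m (delta_mx 0 i)^T : 'M[R]_1) 0 0 = B i i.
  by rewrite trmx_delta -rowE -colE !mxE.
have A0diag i : 0 <= A i i by have := A0 (delta_mx 0 i); rewrite diagE.
have [/existsP[i Aii]|] := boolP [exists i, A i i != 0]; last first.
  rewrite negb_exists => /forallP Adiag0.
  suff -> : A = 0 by rewrite mul0mx mxtrace0.
  apply/matrixP => i j; rewrite !mxE.
  have Ad k : A k k = 0 by apply/eqP; have := Adiag0 k; rewrite negbK.
  (* With a zero diagonal, the form at this vector equals [- 2 * A i j ^+ 2], so nonnegativity
     forces the entry to vanish. *)
  have := A0 (delta_mx 0 i + (- A i j) *: delta_mx 0 j).
  rewrite quadform_add_delta// diagE -rowE !mxE !Ad => h.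
  have : A i j ^+ 2 <= 0 by lra.
  by rewrite le_eqVlt ltNge sqr_ge0 orbF sqrf_eq0 => /eqP.
have Ai_gt0 : 0 < A i i by rewrite lt_neqAle eq_sym Aii A0diag.
(* Subtracting the rank one part of row i keeps A positive semidefinite and
   clears the i-th diagonal entry. *)
pose r := row i A; pose B := A - (A i i)^-1 *: (r^T *m r).
have rE (xi : 'rV_n) : xi *m r^T = ((xi *m A) 0 i)%:M.
  rewrite /r tr_row Asym colE mulmxA -colE [LHS]mx11_scalar !mxE.
  by [].
have rE' (xi : 'rV_n) : r *m xi^T = ((xi *m A) 0 i)%:M.
  by rewrite -[LHS]trmxK trmx_mul trmxK rE tr_scalar_mx.
have Bform (xi : 'rV_n) : (xi *m B *m xi^T) 0 0
    = (xi *m A *m xi^T) 0 0 - (A i i)^-1 * (xi *m A) 0 i ^+ 2.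
  rewrite /B mulmxBr mulmxBl -scalemxAr -scalemxAl mulmxA rE -(mulmxA _ r) rE'.
  by rewrite -scalar_mxM !mxE eqxx mulr1n expr2.
have B0 (xi : 'rV_n) : 0 <= (xi *m B *m xi^T) 0 0.
  (* This multiple of the basis vector minimises the form of [A] along direction [i], and the
     minimum is the form of [B] at [xi]. *)
  have := A0 (xi + (- (A i i)^-1 * (xi *m A) 0 i) *: delta_mx 0 i).
  rewrite Bform quadform_add_delta//; congr (0 <= _).
  by field.
have -> : A = B + (A i i)^-1 *: (r^T *m r) by rewrite /B subrK.
rewrite mulmxDl mxtraceD -scalemxAl mxtraceZ -mulmxA (mxtrace_mulC r^T) trace_mx11.
rewrite -[leRHS]addr0 lerD//; last first.
  by rewrite mulr_ge0_le0 ?invr_ge0 ?A0diag ?Hn.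
have Bdiag j : B j j = A j j - (A i i)^-1 * A j i ^+ 2.
  have := Bform (delta_mx 0 j); rewrite !diagE -rowE [row _ _ _ _]mxE. exact.
apply: (IH B) => //; last by rewrite /B linearB/= linearZ/= trmx_mul trmxK Asym.
(* Zero diagonal entries remain zero: if [A j j = 0], then [B j j] is both nonnegative and minus a
   nonnegative number. Entry [i] is newly cleared, which makes the inclusion strict. *)
apply: leq_trans Am; apply: proper_card; apply/properP; split.
  apply/fintype.subsetP => j; rewrite !inE; apply: contraNneq => Aj.
  have := B0 (delta_mx 0 j); rewrite diagE Bdiag Aj => h.
  apply/eqP; apply/le_anti; rewrite h andbT.
  by rewrite sub0r oppr_le0 mulr_ge0 ?invr_ge0 ?A0diag ?sqr_ge0.
by exists i; rewrite !inE// Bdiag expr2 mulKf// subrr eqxx.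
Qed.

(** * Derivatives along lines and derivative tests at maximum points *)

Lemma is_derive1_line (R : realType) (V : normedModType R) (f : V -> R)
    (x xi : V) (s df : R) :
  is_derive (x + s *: xi) xi f df ->
  is_derive s 1 (fun r : R => f (x + r *: xi)) df.
Proof.
move=> [fx <-].
have E : (fun h : R => h^-1 *: (f (x + (h *: 1 + s) *: xi) - f (x + s *: xi)))
     = (fun h => h^-1 *: (f (h *: xi + (x + s *: xi)) - f (x + s *: xi))).
  by apply/funext => h; rewrite [h *: 1]mulr1 scalerDl addrCA.
by split; rewrite /derivable /derive /= E.
Qed.

(** The left difference quotients are nonnegative. Only times before [t] are compared, since a
    maximum over a time interval may sit at its final time. *)
Lemma derive_ge0_left_max (R : realType) (g : R -> R) (a t dg : R) :
  is_derive t 1 g dg -> a < t -> (forall s, a <= s <= t -> g s <= g t) ->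
  0 <= dg.
Proof.
move=> [gd <-] lt_at gmax.
have c := cvg_dnbhs_at_left gd.
rewrite /derive.
have -> : lim (h^-1 *: (g (h *: 1 + t) - g t) @[h --> 0^'])
  = lim (h^-1 *: (g (h *: 1 + t) - g t) @[h --> 0^'-]).
  by apply/esym/cvg_lim.
apply: limr_ge; first by apply/cvg_ex; eexists; exact: c.
near=> h.
have h0 : h < 0 by near: h; exact: nbhs_left_lt.
rewrite [h *: 1]mulr1 [_ *: _]mulrC nmulr_lge0 ?invr_lt0// subr_le0 gmax//.
apply/andP; split; last by rewrite gerDr ltW.
rewrite -lerBlDr ltW//; near: h; apply: nbhs_left_gt.
by rewrite subr_lt0.
Unshelve. all: by end_near. Qed.

(** If [g2] were positive, [g1], which vanishes at 0, would be positive just to the right of 0, and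
    the mean value theorem would give [g s > g 0] there. *)
Lemma second_derivative_max (R : realType) (g g1 : R -> R) (g2 : R) :
  (\forall s \near (0 : R), is_derive (s : R) 1 g (g1 s)) -> is_derive (0 : R) 1 g1 g2 ->
  (\forall s \near (0 : R), g s <= g 0) -> g1 0 = 0 /\ g2 <= 0.
Proof.
move=> gd g1d gmax.
have : \forall s \near (0 : R), is_derive (s : R) 1 g (g1 s) /\ g s <= g 0 by apply: filterI.
move=> /nbhs_ballP[r /= r0 rP].
have rE (s : R) : `|s| < r -> is_derive (s : R) 1 g (g1 s) /\ g s <= g 0.
  by move=> sr; apply: rP; rewrite /ball/= sub0r normrN.
have g10 : g1 0 = 0.
  have d0 : is_derive (0 : R) 1 g 0.
    apply: (@derive1_at_max _ g (- r) r 0).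
    - by rewrite ge0_cp// ltW.
    - move=> t; rewrite in_itv/= -ltr_norml => /rE[+ _].
      by move=> [].
    - by rewrite in_itv/= oppr_lt0 r0.
    - by move=> t; rewrite in_itv/= -ltr_norml => /rE[].
  have [d1 _] : is_derive (0 : R) 1 g (g1 0) /\ g 0 <= g 0 by apply: rE; rewrite normr0.
  by rewrite -(@derive_val _ _ _ _ _ _ _ d1) (@derive_val _ _ _ _ _ _ _ d0).
split => //; rewrite leNgt; apply/negP => g2_gt0.
case: g1d => g1d g2E.
have : \forall h \near 0^'+, 0 < h^-1 *: (g1 (h *: 1 + 0) - g1 0).
  apply: (cvgr_gt (lim (h^-1 *: (g1 (h *: 1 + 0) - g1 0) @[h --> 0^']))).
    exact: (cvg_dnbhs_at_right g1d).
  by rewrite -[ltRHS]g2E in g2_gt0.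
rewrite /at_right near_withinE => /nbhs_ballP[r' /= r'0 r'P].
pose s := Num.min r r' / 2.
have sr : 0 < s by rewrite divr_gt0// lt_min r0.
have sr1 : s < r by rewrite ltr_pdivrMr// gt_min; apply/orP; left; lra.
have sr2 : s < r' by rewrite ltr_pdivrMr// gt_min; apply/orP; right; lra.
have [c] : exists2 c, c \in `]0, s[ & g s - g 0 = g1 c * (s - 0).
  apply: MVT => //.
    move=> x; rewrite in_itv/= => /andP[x0 xs].
    by apply: (rE _ _).1; rewrite gtr0_norm//; lra.
  apply: derivable_within_continuous => x; rewrite in_itv/= => /andP[x0 xs].
  by have [[]] : is_derive x 1 g (g1 x) /\ g x <= g 0
    by apply: rE; rewrite ger0_norm//; lra.
rewrite in_itv/= subr0 => /andP[c0 cs] gE.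
have g1c : 0 < g1 c.
  have := r'P c; rewrite /ball/= sub0r normrN gtr0_norm//.
  rewrite [_ *: _]mulrC g10 subr0 [c *: 1]mulr1 addr0 => /(_ (lt_trans cs sr2) c0).
  by rewrite pmulr_lgt0 ?invr_gt0.
have := (rE s _).2; rewrite gtr0_norm// => /(_ sr1).
by rewrite -subr_le0 gE leNgt mulr_gt0.
Qed.

(** The base point [q h] moves with [h]. The mean value theorem on the short segment in direction
    [e] writes the quotient as [c] times a value of [p] near [x], and continuity of [p] at [x] gives
    the limit. *)
Lemma cvg_moving_quotient (R : realType) (V : normedModType R) (f p : V -> R)
    (U : set V) (x e : V) (c : R) (q : R -> V) :
  open U -> U x -> (forall y, U y -> is_derive y e f (p y)) ->
  {for x, continuous p} -> q h @[h --> 0^'] --> x ->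
  h^-1 * (f (q h + (h * c) *: e) - f (q h)) @[h --> 0^'] --> c * p x.
Proof.
move=> Uo Ux fp pc qx.
apply/cvgrPdist_le => /= eps eps0.
(* The error in [p] gets multiplied by [c]; adding 1 to the denominator covers [c = 0]. *)
have eps'0 : 0 < eps / (`|c| + 1) by rewrite divr_gt0// ltr_wpDl.
move/cvgrPdist_le : pc => /(_ _ eps'0) pc.
have : \forall y \near x, U y /\ `|p x - p y| <= eps / (`|c| + 1).
  by apply: filterI => //; exact: open_nbhs_nbhs.
move=> /nbhs_normP[r /= r0 rP].
have r20 : 0 < r / 2 by rewrite divr_gt0.
have r3 : 0 < r / 2 / (`|c| * `|e| + 1).
  by rewrite divr_gt0// ltr_wpDl// mulr_ge0.
near=> h.
have h0 : h != 0 by near: h; exact: nbhs_dnbhs_neq.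
have qh : `|x - q h| < r / 2.
  by near: h; move/cvgrPdist_lt : qx; apply.
have hr : `|h| * (`|c| * `|e| + 1) < r / 2.
  rewrite -ltr_pdivlMr ?ltr_wpDl ?mulr_ge0//.
  near: h; exact: dnbhs0_lt.
have segP (s : R) : 0 <= s <= 1 ->
    U (q h + s *: ((h * c) *: e)) /\
    `|p x - p (q h + s *: ((h * c) *: e))| <= eps / (`|c| + 1).
  move=> /andP[s0 s1]; apply: rP => /=.
  rewrite opprD addrA; apply: (le_lt_trans (ler_normB _ _)).
  have : `|s *: ((h * c) *: e)| <= `|h| * (`|c| * `|e| + 1).
    rewrite !normrZ (ger0_norm s0) mulrDr mulr1 -(mulrA `|h|).
    apply: (@le_trans _ _ (1 * (`|h| * (`|c| * `|e|)))); last by rewrite mul1r lerDl.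
    by rewrite ler_wpM2r// !mulr_ge0.
  by lra.
have [s] : exists2 s : R, s \in `[0, 1] &
    f (q h + (1 : R) *: ((h * c) *: e)) - f (q h + (0 : R) *: ((h * c) *: e))
    = h * c * p (q h + s *: ((h * c) *: e)) * (1 - 0).
  have der (s : R) : 0 <= s <= 1 ->
      is_derive s 1 (fun s : R => f (q h + s *: ((h * c) *: e)))
      (h * c * p (q h + s *: ((h * c) *: e))).
    move=> s01.
    have dphi : is_derive (s * (h * c)) 1 (fun r : R => f (q h + r *: e))
        (p (q h + s *: ((h * c) *: e))).
      by apply: is_derive1_line; rewrite -scalerA; apply: fp; exact: (segP s s01).1.
    have -> : (fun s : R => f (q h + s *: ((h * c) *: e)))
      = (fun r : R => f (q h + r *: e)) \o (fun s : R => s * (h * c)).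
      by apply/funext => u /=; rewrite scalerA.
    suff dl : is_derive s 1 (fun s : R => s * (h * c)) (h * c).
      rewrite [_ * p _]mulrC. exact: (@is_derive1_comp R _ _ s _ _ dphi dl).
    have := is_deriveZ (h * c) (is_derive_id s (1 : R)).
    rewrite [_ *: 1]mulr1; congr is_derive.
    by apply/funext => u; exact: mulrC.
  apply: (@MVT_segment _ (fun s : R => f (q h + s *: ((h * c) *: e)))
    (fun s => h * c * p (q h + s *: ((h * c) *: e)))) => //.
    by move=> s; rewrite in_itv/= => /andP[s0 s1]; apply: der; rewrite !ltW.
  apply: derivable_within_continuous => s; rewrite in_itv/= => s01.
  by have [] := der s s01.
rewrite in_itv/= => s01; rewrite scale1r scale0r addr0 => ->.
rewrite subr0 mulr1 !mulrA mulVf// mul1r -mulrBr normrM.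
apply: (@le_trans _ _ (`|c| * (eps / (`|c| + 1)))).
  by rewrite ler_wpM2l// (segP _ _).2.
by rewrite mulrA ler_pdivrMr ?ltr_wpDl// mulrC ler_wpM2l ?lerDl// ltW.
Unshelve. all: by end_near. Qed.

(** The path from [x] to [x + h *: xi] is walked one coordinate at a time through the truncations
    [tr k] of [xi]. The increments telescope, and each one is a moving quotient in a basis
    direction. *)
Lemma is_derive_partials (R : realType) (n : nat) (f : 'rV[R]_n -> R)
    (p : 'I_n -> 'rV[R]_n -> R) (U : set 'rV[R]_n) (x xi : 'rV[R]_n) :
  open U -> U x -> (forall i y, U y -> is_derive y (ebase i) f (p i y)) ->
  (forall i, {for x, continuous (p i)}) ->
  is_derive x xi f (\sum_i xi 0 i * p i x).
Proof.
move=> Uo Ux fp pc.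
pose tr k : 'rV[R]_n := \row_j (if (j < k)%N then xi 0 j else 0).
pose q k (h : R) := x + h *: tr k.
have qS (k : 'I_n) h : q k.+1 h = q k h + (h * xi 0 k) *: ebase k.
  rewrite /q -addrA; congr (_ + _); apply/rowP => j; rewrite !mxE eqxx/=.
  rewrite ltnS leq_eqVlt; have [->|jk] := eqVneq j k.
    by rewrite eqxx ltnn/= mulr0 add0r mulr1.
  by move: jk; rewrite -val_eqE => /negbTE -> /=; rewrite mulr0 addr0.
have trn : tr n = xi by apply/rowP => j; rewrite mxE ltn_ord.
have tr0 : tr 0 = 0 by apply/rowP => j; rewrite !mxE.
have quotE : (fun h => h^-1 *: (f (h *: xi + x) - f x))
   = (fun h => \sum_(k < n) h^-1 * (f (q k h + (h * xi 0 k) *: ebase k) - f (q k h))).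
  apply/funext => h; rewrite -mulr_sumr; congr (_ * _).
  under eq_bigr do rewrite -qS.
  rewrite -(big_mkord xpredT (fun k => f (q k.+1 h) - f (q k h))) telescope_sumr//.
  by rewrite /q trn tr0 scaler0 addr0 (addrC (h *: xi)).
have c : h^-1 *: (f (h *: xi + x) - f x) @[h --> 0^'] --> \sum_i xi 0 i * p i x.
  rewrite quotE; apply: cvg_big => [|k _]; first exact: add_continuous.
  apply: (cvg_moving_quotient Uo Ux (fp k) (pc k)).
  rewrite -[X in _ --> X]addr0 -(scale0r (tr k)); apply: cvg_within_filter.
  by apply: cvgD; [exact: cvg_cst|apply: cvgZ; [exact: cvg_id|exact: cvg_cst]].
by split; [apply/cvg_ex; eexists; exact: c|exact: cvg_lim c].
Qed.

(** Along each line through [x0], the difference of [u] and [h] of coordinate [j0] has a local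
    maximum, so the one-variable test applies. Basis directions yield the gradient, arbitrary
    directions the Hessian form. *)
Lemma max_point_derivatives (R : realType) (n : nat) (u : 'rV[R]_n -> R)
    (D1 : 'I_n -> 'rV[R]_n -> R) (D2 : 'I_n -> 'I_n -> 'rV[R]_n -> R)
    (U : set 'rV[R]_n) (x0 : 'rV[R]_n) (j0 : 'I_n) (h h1 h2 : R -> R) :
  open U -> U x0 ->
  (forall i x, U x -> is_derive x (ebase i) u (D1 i x)) ->
  (forall i x, U x -> {for x, continuous (D1 i)}) ->
  (forall i j x, U x -> is_derive x (ebase i) (D1 j) (D2 i j x)) ->
  (forall i j x, U x -> {for x, continuous (D2 i j)}) ->
  (forall y : R, is_derive y 1 h (h1 y)) ->
  (forall y : R, is_derive y 1 h1 (h2 y)) ->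
  (forall x, U x -> u x - h (x 0 j0) <= u x0 - h (x0 0 j0)) ->
  (forall i, D1 i x0 = h1 (x0 0 j0) * (i == j0)%:R) /\
  (forall xi : 'rV[R]_n, \sum_j xi 0 j * (\sum_i xi 0 i * D2 i j x0)
     <= xi 0 j0 ^+ 2 * h2 (x0 0 j0)).
Proof.
move=> Uo Ux0 uD1 D1c D1D2 D2c hd h1d umax.
have hline (k k' : R -> R) (xi : 'rV[R]_n) (s : R) :
    (forall y : R, is_derive y 1 k (k' y)) ->
    is_derive s 1 (fun s => k (x0 0 j0 + s * xi 0 j0))
      (k' (x0 0 j0 + s * xi 0 j0) * xi 0 j0).
  move=> kk'.
  have dl : is_derive s (1 : R) (fun s : R => x0 0 j0 + s * xi 0 j0) (xi 0 j0).
    apply: is_derive1_line; apply: is_derive_id.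
  exact: (@is_derive1_comp R k _ s _ _ (kk' _) dl).
have scaled (k : R -> R) (s dk c : R) : is_derive s (1 : R) k dk ->
    is_derive s (1 : R) (fun s => k s * c) (dk * c).
  move=> kd; have := is_deriveZ c kd; rewrite [_ *: _]mulrC.
  by congr is_derive; apply/funext => r; exact: mulrC.
have main (xi : 'rV[R]_n) :
    \sum_j xi 0 j * D1 j x0 - h1 (x0 0 j0) * xi 0 j0 = 0 /\
    \sum_j xi 0 j * (\sum_i xi 0 i * D2 i j x0) - h2 (x0 0 j0) * xi 0 j0 * xi 0 j0 <= 0.
  pose g s := u (x0 + s *: xi) - h (x0 0 j0 + s * xi 0 j0).
  pose g1 s := \sum_j xi 0 j * D1 j (x0 + s *: xi) - h1 (x0 0 j0 + s * xi 0 j0) * xi 0 j0.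
  have nU : \forall s \near (0 : R), U (x0 + s *: xi).
    have c : x0 + s *: xi @[s --> (0 : R)] --> x0 + 0 *: xi.
      by apply: cvgD; [exact: cvg_cst|apply: cvgZ; [exact: cvg_id|exact: cvg_cst]].
    by apply: c; rewrite scale0r addr0; exact: open_nbhs_nbhs.
  have [] := @second_derivative_max _ g g1
    (\sum_j xi 0 j * (\sum_i xi 0 i * D2 i j x0) - h2 (x0 0 j0) * xi 0 j0 * xi 0 j0).
  - apply: filterS nU => s Us; apply: (is_deriveB _ (hline _ _ xi s hd)).
    apply: is_derive1_line.
    by apply: (is_derive_partials xi Uo Us uD1) => i; exact: D1c.
  - suff : is_derive (0 : R) 1 g1 (\sum_j xi 0 j * (\sum_i xi 0 i * D2 i j (x0 + 0 *: xi))
        - h2 (x0 0 j0 + 0 * xi 0 j0) * xi 0 j0 * xi 0 j0).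
      by rewrite scale0r mul0r !addr0.
    have d2 : is_derive (0 : R) 1 (fun s => h1 (x0 0 j0 + s * xi 0 j0) * xi 0 j0)
        (h2 (x0 0 j0 + 0 * xi 0 j0) * xi 0 j0 * xi 0 j0).
      exact: scaled (hline _ _ xi 0 h1d).
    apply: (is_deriveB _ d2).
    have -> : (fun s : R => \sum_j xi 0 j * D1 j (x0 + s *: xi))
        = \sum_j (fun s : R => xi 0 j * D1 j (x0 + s *: xi)).
      by apply/funext => s; rewrite fct_sumE.
    apply: is_derive_sum => j.
    under [X in is_derive _ _ X _]eq_fun do rewrite mulrC.
    rewrite mulrC; apply: scaled; apply: is_derive1_line.
    have Ux0' : U (x0 + 0 *: xi) by rewrite scale0r addr0.
    by apply: (is_derive_partials xi Uo Ux0' (D1D2^~ j)) => i; exact: D2c.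
  - apply: filterS nU => s Us; rewrite /g scale0r addr0 mul0r addr0.
    have := umax _ Us; by rewrite !mxE.
  - by rewrite /g1 mul0r scale0r !addr0.
split.
  move=> i; have [+ _] := main (ebase i).
  rewrite (bigD1 i)//= big1 => [|j ji]; last by rewrite mxE (negbTE ji) mul0r.
  by rewrite !mxE !eqxx/= mul1r addr0 (eq_sym j0) => /eqP; rewrite subr_eq0 => /eqP.
move=> xi; have [_] := main xi; rewrite subr_le0 => /le_trans; apply.
by rewrite expr2 mulrC mulrA mulrC mulrA.
Qed.

(** * The comparison principle on a space-time cylinder *)

Lemma cont_on_slice (R : realType) (n : nat) (U : set 'rV[R]_n) (I : set R)
    (f : 'rV[R]_n -> R -> R) (x : 'rV[R]_n) (t : R) :
  open U -> U x -> I t -> cont_on (U `*` I) f -> {for x, continuous (f^~ t)}.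
Proof.
move=> Uo Ux It /subspace_continuousP /(_ (x, t)) /(_ (conj Ux It)) fc.
move=> P /fc /= [[B C] /= [xB tC] BCP].
have xU : nbhs x U by exact: open_nbhs_nbhs.
apply: filterS (filterI xB xU) => y [By Uy].
by apply: (BCP (y, t)) => //=; split=> //; exact: nbhs_singleton.
Qed.

Lemma compact_closure (R : realType) (n : nat) (U : set 'rV[R]_n) :
  bounded_set U -> compact (closure U).
Proof.
move=> [M [Mr UM]]; apply: bounded_closed_compact; last exact: closed_closure.
exists M; split=> // r Mr' x; change (closure U x -> [set y : 'rV[R]_n | `|y| <= r] x).
have rc : closed [set y : 'rV[R]_n | `|y| <= r].
  rewrite -[X in closed X]/((fun y : 'rV[R]_n => `|y|) @^-1` [set z : R | z <= r]).
  by apply: closed_comp; [move=> y _; exact: norm_continuous|exact: closed_le].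
by rewrite ((closure_id _).1 rc); apply: (closureS (UM r Mr')).
Qed.

(** The right-hand side of the strict inequality is the operator applied to [a t * h (x 0 j0)]. If
    the maximum of [sigma * w - a * h] over the compact cylinder were positive, it would lie over
    [U] at a time after [s]. There the gradients agree, the time derivative of the difference is
    nonnegative and its Hessian is nonpositive, which contradicts strictness. The factor [sigma]
    lets one statement serve [w] and [- w]. *)
Lemma parabolic_comparison (R : realType) (n : nat) (U : set 'rV[R]_n)
    (A : 'rV[R]_n -> R -> 'M[R]_n) (b : 'rV[R]_n -> R -> 'rV[R]_n)
    (w : 'rV[R]_n -> R -> R) (s T sigma : R) (j0 : 'I_n)
    (a a' h h1 h2 : R -> R) :
  open U -> bounded_set U -> 0 <= s ->
  cont_on (closure U `*` `[s, T]) w -> C21 U `]0, +oo[ w ->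
  (forall t, s <= t <= T -> is_derive t 1 a (a' t)) ->
  (forall t, s <= t <= T -> 0 <= a t) ->
  (forall y : R, is_derive y 1 h (h1 y)) ->
  (forall y : R, is_derive y 1 h1 (h2 y)) ->
  (forall x t, U x -> s < t -> (A x t)^T = A x t) ->
  (forall x t, U x -> s < t -> forall xi : 'rV[R]_n, 0 <= (xi *m A x t *m xi^T) 0 0) ->
  (forall x t, U x -> s < t <= T -> sigma * Lop A b w x t <
     a' t * h (x 0 j0) - a t * h2 (x 0 j0) * A x t j0 j0
     + b x t 0 j0 * (a t * h1 (x 0 j0))) ->
  (forall x, closure U x -> sigma * w x s <= a s * h (x 0 j0)) ->
  (forall x t, boundary U x -> s <= t <= T -> sigma * w x t <= a t * h (x 0 j0)) ->
  forall x t, closure U x -> s <= t <= T -> sigma * w x t <= a t * h (x 0 j0).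
Proof.
move=> Uo Ub s_ge0 wc [_ [wt _] wx wxx] ad a_ge0 hd h1d Asym Apsd strict init lat.
move=> x1 t1 Ux1 st1.
pose v (p : 'rV[R]_n * R) := sigma * w p.1 p.2 - a p.2 * h (p.1 0 j0).
have Uc : compact (closure U).
  exact: compact_closure.
have st : s <= T by case/andP: st1 => /le_trans; apply.
have vc : {within closure U `*` `[s, T], continuous v}.
  apply/subspace_continuousP => -[x t] [/= Ux tst].
  move/subspace_continuousP : wc => /(_ (x, t) (conj Ux tst)) wc.
  apply: cvgB; first by apply: cvgM; [exact: cvg_cst|exact: wc].
  apply: cvg_within_filter; apply: cvgM.
    have ac : {for t, continuous a}.
      apply/differentiable_continuous/derivable1_diffP.
      by have [] := ad t tst.
    by apply: (@continuous_comp _ _ _ snd a (x, t)); [exact: cvg_snd|exact: ac].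
  have hc : {for x 0 j0, continuous h}.
    apply/differentiable_continuous/derivable1_diffP.
    by have [] := hd (x 0 j0).
  apply: (@continuous_comp _ _ _ (fun p : 'rV[R]_n * R => p.1 0 j0) h (x, t));
    last exact: hc.
  apply: (@continuous_comp _ _ _ fst (fun y : 'rV[R]_n => y 0 j0) (x, t)).
    exact: cvg_fst.
  exact: coord_continuous.
have [[x0 t0] /set_mem/= [Ux0 /= t0st] vmax] : exists2 c,
    c \in closure U `*` `[s, T] & forall t, t \in closure U `*` `[s, T] -> v t <= v c.
  apply: compact_EVT_max => //; first by exists (x1, t1); split.
  by apply: compact_setX => //; exact: segment_compact.
rewrite in_itv/= in t0st.
rewrite -subr_le0 -[_ - _]/(v (x1, t1)).
apply: le_trans (vmax _ _) _; first by rewrite inE; split => //=; rewrite in_itv.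
rewrite leNgt; apply/negP => v_gt0.
have {}vmax x t : closure U x -> s <= t <= T -> v (x, t) <= v (x0, t0).
  by move=> Ux tst; apply: vmax; rewrite inE; split => //=; rewrite in_itv.
have Ux0' : U x0.
  apply: contrapT => nUx0; move: v_gt0; rewrite ltNge subr_le0 lat//.
  by split => //; rewrite (proj1 (interior_id _) Uo).
have s_lt_t0 : s < t0.
  rewrite lt_neqAle (andP t0st).1 andbT; apply/eqP => st0.
  by move: v_gt0; rewrite -st0 ltNge subr_le0 init.
have t0_gt0 : 0 < t0 by exact: le_lt_trans s_lt_t0.
have It0 : `]0, +oo[%classic t0 by rewrite /= in_itv/= t0_gt0.
(* The time [t0] may equal [T], so only comparison with earlier times is available. *)
have time : 0 <= sigma * dt w x0 t0 - a' t0 * h (x0 0 j0).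
  have wtd : is_derive t0 (1 : R) (w x0) (dt w x0 t0).
    by apply: DeriveDef; [exact: wt|rewrite /dt derive1E].
  have d1 := is_deriveZ sigma wtd.
  have d2 := is_deriveZ (h (x0 0 j0)) (ad t0 t0st).
  have := @derive_ge0_left_max _ _ s t0 _ (is_deriveB d1 d2) s_lt_t0.
  rewrite -[_ *: a' t0]/(h (x0 0 j0) * a' t0) (mulrC (h _)); apply => r /andP[sr rt0].
  have := vmax x0 r Ux0; rewrite /v/= !(mulrC (a _)); apply.
  by rewrite sr (le_trans rt0 (andP t0st).2).
have sc (f : 'rV[R]_n -> R -> R) x : U x -> cont_on (U `*` `]0, +oo[) f ->
    {for x, continuous (fun x => sigma * f x t0)}.
  move=> Ux fc; have c := cont_on_slice Uo Ux It0 fc.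
  have k : (fun=> sigma) @ nbhs x --> sigma by exact: cvg_cst.
  exact: (cvgM k c).
have [grad_eq hess_le] := @max_point_derivatives R n (fun x => sigma * w x t0)
   (fun i x => sigma * dx i w x t0) (fun i j x => sigma * dx i (dx j w) x t0)
   U x0 j0 (fun y => a t0 * h y) (fun y => a t0 * h1 y) (fun y => a t0 * h2 y) Uo Ux0'
   (fun i x Ux => is_deriveZ sigma (DeriveDef ((wx i).1 x t0 Ux It0) erefl))
   (fun i x Ux => sc _ _ Ux (wx i).2)
   (fun i j x Ux => is_deriveZ sigma (DeriveDef ((wxx i j).1 x t0 Ux It0) erefl))
   (fun i j x Ux => sc _ _ Ux (wxx i j).2)
   (fun y => is_deriveZ (a t0) (hd y)) (fun y => is_deriveZ (a t0) (h1d y))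
   (fun x Ux => vmax x t0 (@subset_closure _ _ _ Ux) t0st).
have := strict x0 t0 Ux0'; rewrite s_lt_t0 (andP t0st).2 => /(_ isT).
apply/negP; rewrite -leNgt /Lop.
have bterm : sigma * dotp (b x0 t0) (grad w x0 t0)
    = b x0 t0 0 j0 * (a t0 * h1 (x0 0 j0)).
  rewrite /dotp mulr_sumr (bigD1 j0)//= big1 => [|i ij].
    by rewrite addr0 mxE mulrCA grad_eq eqxx mulr1.
  by rewrite mxE mulrCA grad_eq (negbTE ij) !mulr0.
(* [H] is the Hessian of the difference at the maximum; the barrier depends on coordinate [j0] only
   and so affects a single entry. *)
pose H : 'M[R]_n := sigma *: hess w x0 t0 - (a t0 * h2 (x0 0 j0)) *: delta_mx j0 j0.
have trH : \tr (A x0 t0 *m H) <= 0.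
  apply: mxtrace_sym_psd_le0; first exact: Asym.
    by move=> xi; apply: Apsd.
  move=> xi; have := hess_le xi; rewrite -subr_le0; congr (_ <= 0).
  have dE : (xi *m delta_mx j0 j0 *m xi^T) 0 0 = xi 0 j0 ^+ 2.
    rewrite -(mul_delta_mx (0 : 'I_1)) mulmxA -mulmxA -colE -rowE !mxE big_ord1 !mxE.
    by rewrite expr2.
  have hE : (xi *m hess w x0 t0 *m xi^T) 0 0
      = \sum_j xi 0 j * (\sum_i xi 0 i * dx i (dx j w) x0 t0).
    rewrite mxE; apply: eq_bigr => j _; rewrite !mxE mulrC; congr (_ * _).
    by apply: eq_bigr => i _; rewrite mxE.
  rewrite mulmxBr mulmxBl -!scalemxAr -!scalemxAl; move: dE hE.
  move: (_ *m _) (_ *m delta_mx _ _ *m _) => p q; rewrite !mxE => -> ->.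
  rewrite mulr_sumr; congr (_ - _); last by rewrite mulrC.
  by apply: eq_bigr => j _; rewrite mulrCA; congr (_ * _);
    rewrite mulr_sumr; apply: eq_bigr => i _; rewrite mulrCA.
have trHE : \tr (A x0 t0 *m H) = sigma * mxinner (A x0 t0) (hess w x0 t0)
    - a t0 * h2 (x0 0 j0) * A x0 t0 j0 j0.
  rewrite /mxinner Asym// mulmxBr -!scalemxAr linearB/= !linearZ/=.
  rewrite -(mul_delta_mx (0 : 'I_1)) mulmxA (mxtrace_mulC (A x0 t0 *m _)) -colE -rowE.
  by rewrite trace_mx11 [row _ _ _ _]mxE [col _ _ _ _]mxE.
rewrite mulrDr mulrBr bterm lerD2r; move: trH time; rewrite trHE; lra.
Qed.

(** * A scalar recursion and two facts on integrals *)

(** While [J k > 2 * eps], each step lowers [J] by at least [eps * theta k], which the divergent sum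
    and [J >= 0] do not allow forever. Once below [2 * eps], the sequence stays there, being bounded
    by a convex combination of [J k] and [eps]. *)
Lemma relaxation_eventually_le (R : realType) (J theta : nat -> R) (eps : R) :
  0 < eps -> (forall k, 0 <= J k) -> (forall k, 0 <= theta k <= 1) ->
  (forall k, J k.+1 <= J k - theta k * (J k - eps)) ->
  (forall M, exists m, M < \sum_(k < m) theta k) ->
  exists K, forall k, (K <= k)%N -> J k <= 2 * eps.
Proof.
move=> eps0 J0 th JS div.
have [K JK] : exists K, J K <= 2 * eps.
  apply: contrapT => /forallNP Jgt.
  have JgtE k : 2 * eps < J k by rewrite ltNge; apply/negP/Jgt.
  have Jle m : J m <= J 0%N - eps * \sum_(k < m) theta k.
    elim: m => [|m IH]; first by rewrite big_ord0 mulr0 subr0.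
    rewrite big_ord_recr/= mulrDr.
    have /andP[t0 t1] := th m; have Jm := ltW (JgtE m); have := JS m.
    have : 0 <= theta m * (J m - 2 * eps) by rewrite mulr_ge0// subr_ge0.
    by lra.
  have [m] := div (J 0%N / eps); rewrite ltr_pdivrMr// mulrC => mdiv.
  by have := Jle m; have := J0 m; lra.
exists K => k /subnKC <-; elim: (k - K)%N => [|i IH]; first by rewrite addn0.
rewrite addnS; apply: le_trans (JS _) _; have /andP[t0 t1] := th (K + i)%N.
nra.
Qed.

(** The integral is based at [T], strictly to the left of [s], so that its derivative is two-sided
    even at [t = s]. The bounds come from [F >= 0]. *)
Lemma antiderivative_continuous (R : realType) (F : R -> R) (T s : R) :
  {within `[T, +oo[, continuous F} -> (forall t, T <= t -> 0 <= F t) -> T < s ->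
  exists I : R -> R, forall t, s <= t <= s + 1 ->
    is_derive t 1 I (F t) /\
    I s <= I t <= I s + \int[lebesgue_measure]_(x in `[s, s + 1]) F x.
Proof.
move=> Fc F0 Ts.
have Fint (u v : R) : T <= u -> lebesgue_measure.-integrable `[u, v] (EFin \o F).
  move=> Tu; apply: continuous_compact_integrable; first exact: segment_compact.
  apply: continuous_subspaceW Fc => x /=; rewrite !in_itv/= andbT => /andP[ux _].
  exact: le_trans ux.
have Fct t : T < t -> {for t, continuous F}.
  move=> Tt; have : {within `]T, +oo[, continuous F}.
    by apply: continuous_subspaceW Fc => x /=; rewrite !in_itv/= !andbT => /ltW.
  rewrite continuous_open_subspace; first by apply; rewrite inE/= in_itv/= Tt.
  exact: interval_open.
pose I t := \int[lebesgue_measure]_(x in `[T, t]) F x.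
have Idiff (u v : R) : T <= u -> u <= v ->
    I v - I u = \int[lebesgue_measure]_(x in `]u, v]) F x.
  move=> Tu uv; apply: (@Rintegral_itvB _ F (BLeft T) (BRight v) u); rewrite ?bnd_simp//.
  exact: Fint.
have Imono (u v : R) : T <= u -> u <= v -> I u <= I v.
  move=> Tu uv; rewrite -subr_ge0 Idiff//; apply: Rintegral_ge0 => x /=.
  by rewrite in_itv/= => /andP[ux _]; rewrite F0// (le_trans Tu)// ltW.
exists I => t /andP[st ts].
have Tt := lt_le_trans Ts st.
split; last first.
  rewrite Imono//=; last exact: ltW.
  apply: (@le_trans _ _ (I (s + 1))); first by rewrite Imono// ltW.
  rewrite -lerBlDl Idiff ?lerDl//; last exact: ltW.
  rewrite (@Rintegral_itv_obnd_cbnd _ s (BRight (s + 1)) F)//.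
  apply: (integrableS _ _ _ (Fint s (s + 1) (ltW Ts))) => //.
  by apply: subset_itvr; rewrite bnd_simp.
have [d dE] := @continuous_FTC1_closed _ F T t (t + 1) (ltr_pwDr ltr01 (lexx t))
   (Fint _ _ (lexx T)) Tt (Fct t Tt).
by apply: DeriveDef; [exact: d|rewrite -derive1E].
Qed.

(** As [g] decreases, its integral over a unit interval is at most its value at the left end.
    Bounded sums would thus bound the integrals over [[T, s + m]], which tend to infinity by
    monotone convergence. *)
Lemma sum_unit_steps_unbounded (R : realType) (g : R -> R) (T s : R) :
  T <= s -> {within `[T, +oo[, continuous g} -> (forall t, T <= t -> 0 <= g t) ->
  (forall t u, T <= t -> t <= u -> g u <= g t) ->
  (\int[lebesgue_measure]_(x in `[T, +oo[) (g x)%:E)%E = +oo%E ->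
  forall M, exists m, M < \sum_(k < m) g (s + k%:R).
Proof.
move=> Ts gc g0 gdecr ginf M; apply: contrapT => /forallNP sumle.
have {}sumle m : \sum_(k < m) g (s + k%:R) <= M by rewrite leNgt; apply/negP/sumle.
have gint (u v : R) : T <= u -> lebesgue_measure.-integrable `[u, v] (EFin \o g).
  move=> Tu; apply: continuous_compact_integrable; first exact: segment_compact.
  apply: continuous_subspaceW gc => x /=; rewrite !in_itv/= andbT => /andP[ux _].
  exact: le_trans ux.
pose I t := \int[lebesgue_measure]_(x in `[T, t]) g x.
have bound m : I (s + m%:R) <= I s + \sum_(k < m) g (s + k%:R).
  elim: m => [|m IH]; first by rewrite big_ord0 !addr0.
  have sm : s + m%:R <= s + m.+1%:R by rewrite lerD2l ler_nat.
  have Tm : T <= s + m%:R by rewrite (le_trans Ts)// lerDl.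
  have sub1 : `]s + m%:R, s + m.+1%:R] `<=` `[s + m%:R, s + m.+1%:R].
    by apply: subset_itvr; rewrite bnd_simp.
  rewrite big_ord_recr/= addrA -lerBlDl.
  apply: (@le_trans _ _ (I (s + m.+1%:R) - I (s + m%:R))); first by rewrite lerB.
  rewrite /I (@Rintegral_itvB _ g (BLeft T) (BRight (s + m.+1%:R)) (s + m%:R))
    ?bnd_simp//; last exact: gint.
  apply: (@le_trans _ _
    (\int[lebesgue_measure]_(x in `]s + m%:R, s + m.+1%:R]) g (s + m%:R))).
    apply: le_Rintegral => //.
    - by apply: (integrableS _ _ _ (gint _ (s + m.+1%:R) Tm)).
    - have ci : lebesgue_measure.-integrable `[s + m%:R, s + m.+1%:R]
          (EFin \o (fun=> g (s + m%:R))).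
        apply: continuous_compact_integrable; first exact: segment_compact.
        by apply: continuous_subspaceT => x; exact: cvg_cst.
      by apply: (integrableS _ _ _ ci).
    - by move=> x /=; rewrite in_itv/= => /andP[/ltW sx _]; exact: gdecr.
  rewrite Rintegral_cst//= lebesgue_measure_itv/= lte_fin ltrD2l ltr_nat ltnSn.
  by rewrite -EFinB/= -[m.+1%:R]natr1; lra.
have : (\int[lebesgue_measure]_(x in `[T, (s + m%:R)%R]) (g x)%:E)%E @[m --> \oo] --> +oo%E.
  rewrite -ginf.
  have -> : `[T, +oo[%classic = \bigcup_m `[T, s + m%:R]%classic.
    apply/seteqP; split => x /=; rewrite in_itv/= ?andbT.
      move=> Tx; exists (Num.bound `|x - s|) => //=; rewrite in_itv/= Tx/=.
      by rewrite -lerBlDl (le_trans (ler_norm _))// ltW// archi_boundP.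
    by move=> [m _]; rewrite /= in_itv/= => /andP[].
  apply: ge0_nondecreasing_set_cvg_integral => //.
  - move=> i j ij; apply/subsetPset; apply: subset_itvl; rewrite bnd_simp.
    by rewrite lerD2l ler_nat.
  - by move=> i; exact: measurable_int (gint T (s + i%:R) (lexx T)).
  - by move=> i x /=; rewrite in_itv/= => /andP[Tx _]; rewrite lee_fin g0.
move=> /cvgeyPgt/(_ (I s + M))[N _ /(_ N (leqnn N))]; rewrite ltNge => /negP; apply.
rewrite -[leLHS]fineK; last by apply: integrable_fin_num => //; exact: gint.
by rewrite lee_fin (le_trans (bound N))// lerD2l.
Qed.

(** * The exponential barrier and the decay over one unit of time *)

Lemma normr_coord_le_enorm (R : realType) (n : nat) (x : 'rV[R]_n) (i : 'I_n) :
  `|x 0 i| <= enorm x.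
Proof.
rewrite -sqrtr_sqr ler_sqrt ?sumr_ge0// => [|j _]; last by rewrite -expr2 sqr_ge0.
by rewrite /dotp (bigD1 i)//= expr2 lerDl sumr_ge0// => j _; rewrite -expr2 sqr_ge0.
Qed.

(** For [mu > 0] this is decreasing and concave in [y]: concavity lets ellipticity beat the drift.
    The division by 2 keeps the values at least 1/2 where [y <= c]. *)
Definition exp_barrier (R : realType) (mu c y : R) : R :=
  1 - expR (mu * (y - c)) / 2.

Lemma is_derive_exp_affine (R : realType) (mu c k y : R) :
  is_derive y 1 (fun y => k * expR (mu * (y - c))) (k * mu * expR (mu * (y - c))).
Proof.
have d1 : is_derive y (1 : R) (fun y => mu * (y - c)) mu.
  have := is_deriveZ mu (is_deriveB (is_derive_id y (1 : R)) (is_derive_cst c y (1 : R))).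
  by rewrite subr0 [_ *: 1]mulr1.
have := is_deriveZ k (@is_derive1_comp R expR _ y _ _ (is_derive_expR _) d1).
by rewrite [_ *: _](_ : _ = k * mu * expR (mu * (y - c)))// /GRing.scale/=; ring.
Qed.

Lemma is_derive_exp_barrier (R : realType) (mu c y : R) :
  is_derive y 1 (exp_barrier mu c) (- (mu / 2) * expR (mu * (y - c))).
Proof.
have := is_deriveB (is_derive_cst (1 : R) y (1 : R)) (is_derive_exp_affine mu c 2^-1 y).
rewrite sub0r mulNr [mu / 2]mulrC; congr is_derive.
by apply/funext => z; rewrite /exp_barrier mulrC.
Qed.

Lemma exp_barrier_bounds (R : realType) (mu c y : R) :
  0 <= mu -> y <= c -> 1 / 2 <= exp_barrier mu c y <= 1.
Proof.
move=> mu0 yc; rewrite /exp_barrier.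
have : expR (mu * (y - c)) <= expR 0.
  by rewrite ler_expR mulr_ge0_le0// subr_le0.
rewrite expR0; have := expR_gt0 (mu * (y - c)); lra.
Qed.

Lemma exp_barrier_mono (R : realType) (mu nu c y : R) :
  mu <= nu -> y <= c -> exp_barrier mu c y <= exp_barrier nu c y.
Proof.
move=> munu yc; rewrite lerD2l lerN2 ler_wpM2r ?invr_ge0// ler_expR.
by rewrite ler_wnM2r// subr_le0.
Qed.

(** The choice of [mu] makes [c0 * mu - z] equal to [c0], so the second-order term exceeds the drift
    term by a definite amount, and [parabolic_comparison] applies to a decaying multiple of the
    barrier. *)
Lemma barrier_step (R : realType) (n : nat) (U : set 'rV[R]_n)
    (A : 'rV[R]_n -> R -> 'M[R]_n) (b : 'rV[R]_n -> R -> 'rV[R]_n)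
    (w : 'rV[R]_n -> R -> R) (F I : R -> R)
    (s c0 z c d J B K theta : R) (j0 : 'I_n) :
  open U -> bounded_set U -> 0 <= s -> 0 < c0 -> 0 <= z ->
  cont_on (closure U `*` `[s, s + 1]) w -> C21 U `]0, +oo[ w ->
  (forall x, closure U x -> c - d <= x 0 j0 <= c) ->
  (forall x t, U x -> s < t -> (A x t)^T = A x t) ->
  (forall x t, U x -> s < t -> forall xi : 'rV[R]_n,
     c0 * enorm xi ^+ 2 <= (xi *m A x t *m xi^T) 0 0) ->
  (forall x t, U x -> s < t <= s + 1 -> enorm (b x t) <= z) ->
  (forall x t, U x -> s < t <= s + 1 -> `|Lop A b w x t| <= F t) ->
  (forall t, s <= t <= s + 1 -> 0 <= F t) ->
  (forall t, s <= t <= s + 1 -> is_derive t 1 I (F t) /\ I s <= I t <= I s + K) ->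
  0 <= B -> (forall x t, boundary U x -> s <= t <= s + 1 -> `|w x t| <= B) ->
  let mu := z / c0 + 1 in
  0 <= J -> 0 <= theta <= 1 / 2 -> 2 * theta <= c0 * mu / 2 * expR (- (mu * d)) ->
  (forall x, closure U x -> `|w x s| <= J * exp_barrier mu c (x 0 j0)) ->
  forall x t, closure U x -> s <= t <= s + 1 ->
    `|w x t| <= (J * (1 - theta * (t - s)) + 2 * (B + K)) * exp_barrier mu c (x 0 j0).
Proof.
move=> Uo Ub s0 c00 z0 wc wC21 xjc Asym Aell bz LF F0 Ider B0 wB mu J0.
move=> /andP[th0 th1] thk init x t Ux st.
have mu_gt0 : 0 < mu by rewrite ltr_wpDl// divr_ge0// ltW.
have zmu : z = c0 * (mu - 1) by rewrite /mu addrK mulrC divfK// gt_eqF.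
pose h := exp_barrier mu c.
pose e y := expR (mu * (y - c)).
have hb y : y <= c -> 1 / 2 <= h y <= 1 by exact: exp_barrier_bounds (ltW mu_gt0).
have h1d (y : R) : is_derive y 1 (fun y => - (mu / 2) * e y) (- (mu / 2) * mu * e y).
  exact: is_derive_exp_affine.
have xc y : closure U y -> y 0 j0 <= c by move=> /xjc /andP[].
have enormE (xi : 'rV[R]_n) : enorm xi ^+ 2 = dotp xi xi.
  by rewrite sqr_sqrtr// sumr_ge0// => i _; rewrite -expr2 sqr_ge0.
(* The cases [sigma = 1] and [sigma = -1] combine to the absolute value, and [h <= 1] allows [eps]
   to be removed in the limit. *)
suff main (sigma eps : R) : `|sigma| <= 1 -> 0 < eps ->
    sigma * w x t <= (J * (1 - theta * (t - s)) + 2 * (B + K) + eps) * h (x 0 j0).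
  have {}main (sigma : R) : `|sigma| <= 1 ->
      sigma * w x t <= (J * (1 - theta * (t - s)) + 2 * (B + K)) * h (x 0 j0).
    move=> sig1; apply/ler_addgt0Pr => eps eps0; apply: le_trans (main _ _ sig1 eps0) _.
    by have /hb/andP[_ h1] := xc _ Ux; rewrite mulrDl lerD2l ger_pMr.
  rewrite ler_norml; apply/andP; split.
    by rewrite lerNl -mulN1r main// normrN normr1.
  by rewrite -[w x t]mul1r main// normr1.
move=> sig1 eps0.
have sigw y t' : sigma * w y t' <= `|w y t'|.
  by apply: le_trans (ler_norm _) _; rewrite normrM ler_piMl.
(* The factors 2 compensate h >= 1/2, and eps makes the differential
   inequality strict.  As theta (t - s) <= 1/2, we have a >= J/2, so that the
   gain a * k >= J * theta absorbs the decay of a. *)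
pose a t := J * (1 - theta * (t - s)) + (2 * B + eps) + 2 * (I t - I s).
pose a' t := - (J * theta) + 2 * F t.
have a_ge t' : s <= t' <= s + 1 -> J / 2 + 2 * B + eps <= a t'.
  move=> t'st; have [_ /andP[I0 I1]] := Ider _ t'st; rewrite /a.
  have : 0 <= J * (1 / 2 - theta * (t' - s)) by apply: mulr_ge0 => //; nra.
  by lra.
apply: (@le_trans _ _ (a t * h (x 0 j0))); last first.
  have [_ /andP[I0 I1]] := Ider _ st.
  apply: ler_wpM2r; first by have /hb/andP[h1 _] := xc _ Ux; lra.
  by rewrite /a; lra.
apply: (@parabolic_comparison R n U A b w s (s + 1) sigma j0 a a' h
  (fun y => - (mu / 2) * e y) (fun y => - (mu / 2) * mu * e y)
  Uo Ub s0 wc wC21 _ _ _ h1d Asym _ _ _ _ x t Ux st).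
- move=> t' t'st; have [Id _] := Ider _ t'st.
  pose k := J * (1 + theta * s) + (2 * B + eps) - 2 * I s.
  have dZ (r df : R) (f : R -> R) : is_derive t' (1 : R) f df ->
      is_derive t' (1 : R) (fun u => r * f u) (r * df).
    by move=> fd; exact: (is_deriveZ r fd).
  have := is_deriveD (is_deriveD (is_derive_cst k t' (1 : R))
    (dZ (- (J * theta)) _ _ (is_derive_id t' (1 : R)))) (dZ 2 _ _ Id).
  rewrite add0r mulr1; congr is_derive.
  by apply/funext => u; rewrite /a /k !fctE; ring.
- by move=> t' t'st; apply: le_trans (a_ge _ t'st); lra.
- exact: is_derive_exp_barrier.
- move=> y t' Uy st' xi; apply: le_trans (Aell y t' Uy st' xi).
  by rewrite mulr_ge0 ?sqr_ge0 ?(ltW c00).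
- move=> y t' Uy st'.
  have cUy := subset_closure Uy; have t'st : s <= t' <= s + 1 by lra.
  have /andP[Y1 Y2] := xjc _ cUy; have /andP[h1 h2] := hb _ Y2.
  have Ajj : c0 <= A y t' j0 j0.
    have := Aell y t' Uy (andP st').1 (ebase j0).
    rewrite enormE trmx_delta -rowE -colE !mxE; apply: le_trans.
    rewrite /dotp (bigD1 j0)//= !mxE !eqxx big1 ?addr0 ?mulr1//.
    by move=> i /negbTE ij; rewrite !mxE ij mulr0.
  have bj : b y t' 0 j0 <= z.
    apply: le_trans (ler_norm _) _; apply: le_trans (bz y t' Uy st').
    exact: normr_coord_le_enorm.
  have El : expR (- (mu * d)) <= e (y 0 j0).
    have : 0 <= mu * (y 0 j0 - (c - d)) by rewrite mulr_ge0 ?subr_ge0 ?(ltW mu_gt0).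
    by rewrite ler_expR; lra.
  have Lle : sigma * Lop A b w y t' <= F t'.
    apply: le_trans (LF y t' Uy st'); apply: le_trans (ler_norm _) _.
    by rewrite normrM ler_piMl.
  apply: le_lt_trans Lle _.
  (* [G] is the operator applied to the weight alone; applied to the product with [a], it gives
     [a' * h + a * G]. *)
  set G := mu / 2 * e (y 0 j0) * (mu * A y t' j0 j0 - b y t' 0 j0).
  have -> : a' t' * h (y 0 j0) - a t' * (- (mu / 2) * mu * e (y 0 j0)) * A y t' j0 j0 +
     b y t' 0 j0 * (a t' * (- (mu / 2) * e (y 0 j0))) = a' t' * h (y 0 j0) + a t' * G.
    by rewrite /G; ring.
  set k := c0 * mu / 2 * expR (- (mu * d)) in thk.
  have k0 : 0 < k by rewrite !mulr_gt0// expR_gt0.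
  (* The last factor of [G] is at least [mu * c0 - z = c0], and the exponential is smallest at the
     far side of the slab. *)
  have kG : k <= G.
    have -> : k = mu / 2 * expR (- (mu * d)) * c0 by rewrite /k; ring.
    rewrite ler_pM ?mulr_ge0 ?expR_ge0 ?divr_ge0 ?(ltW mu_gt0) ?(ltW c00)//.
      by rewrite ler_wpM2l ?divr_ge0// ltW.
    have : mu * c0 <= mu * A y t' j0 j0 by rewrite ler_wpM2l// ltW.
    by rewrite zmu in bj; lra.
  have aG : J * theta + eps * k <= a t' * G.
    apply: (@le_trans _ _ ((J / 2 + eps) * k)).
      have : 0 <= J * (k - 2 * theta) by rewrite mulr_ge0// subr_ge0.
      by lra.
    apply: ler_pM => //; [lra|exact: ltW|].
    by apply: le_trans (a_ge _ t'st); lra.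
  have ek : 0 < eps * k by rewrite mulr_gt0.
  have : 0 <= J * theta * (1 - h (y 0 j0)) by rewrite !mulr_ge0// subr_ge0.
  have : 0 <= F t' * (h (y 0 j0) - 1 / 2) by rewrite mulr_ge0 ?F0// subr_ge0.
  by rewrite /a'; lra.
- move=> y Uy; apply: le_trans (sigw _ _) _; apply: le_trans (init _ Uy) _.
  have /hb/andP[h1 h2] := xc _ Uy.
  by apply: ler_wpM2r; [rewrite -/h; lra|rewrite /a; lra].
- move=> y t' Uy t'st; apply: le_trans (sigw _ _) _; apply: le_trans (wB _ _ Uy t'st) _.
  have /hb/andP[h1 h2] : y 0 j0 <= c by apply: xc; case: Uy.
  apply: (@le_trans _ _ (2 * B * h (y 0 j0))); first by nra.
  by apply: ler_wpM2r; [lra|apply: le_trans (a_ge _ t'st); lra].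
Qed.

(** * Geometry of the domain: diameter and coordinate range *)

Lemma enorm_le_norm (R : realType) (n : nat) (x : 'rV[R]_n) :
  enorm x <= Num.sqrt n%:R * `|x|.
Proof.
have xi i : `|x 0 i| <= `|x|.
  by rewrite [leRHS]mx_normrE; apply: (le_bigmax _ (fun ij => `|x ij.1 ij.2|) (0, i)).
rewrite -[leRHS]ger0_norm ?mulr_ge0 ?sqrtr_ge0// -sqrtr_sqr exprMn sqr_sqrtr//.
rewrite ler_sqrt; last by rewrite mulr_ge0// sqr_ge0.
have -> : n%:R * `|x| ^+ 2 = \sum_(i < n) `|x| ^+ 2 by rewrite sumr_const card_ord mulr_natl.
apply: ler_sum => i _.
by rewrite -expr2 -real_normK ?num_real// lerXn2r ?nnegrE.
Qed.

(** The point is that the set of distances is bounded above, so that its [sup] is a genuine upper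
    bound; this is seen through the library norm. *)
Lemma enorm_le_diameter (R : realType) (n : nat) (U : set 'rV[R]_n)
    (x y : 'rV[R]_n) :
  bounded_set U -> closure U x -> closure U y -> enorm (x - y) <= diameter U.
Proof.
move=> /compact_closure/compact_bounded [M [_ /(_ (M + 1))]].
rewrite ltrDl => /(_ ltr01) UM Ux Uy; apply: ub_le_sup; last by exists x => //; exists y.
exists (Num.sqrt n%:R * (2 * (M + 1))) => _ [u Uu [v Uv <-]].
apply: le_trans (enorm_le_norm _) _; rewrite ler_wpM2l ?sqrtr_ge0//.
apply: le_trans (ler_normB _ _) _; rewrite mulr2n mulrDl mul1r.
by rewrite lerD//; apply: UM.
Qed.

(** A small ball around a point [x] of [U] contains a diagonal translate of [x], and the two differ
    in coordinate 0. *)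
Lemma diameter_gt0 (R : realType) (n : nat) (U : set 'rV[R]_n) :
  (0 < n)%N -> open U -> U !=set0 -> bounded_set U -> 0 < diameter U.
Proof.
case: n U => // n U _ Uo [x Ux] Ub.
have : nbhs x U by exact: open_nbhs_nbhs.
move=> /nbhs_ballP[r /= r0 rU].
pose y : 'rV[R]_n.+1 := x + const_mx (r / 2).
have Uy : U y.
  apply: rU; rewrite -ball_normE/= /y opprD addNKr normrN.
  rewrite [ltLHS]mx_normrE; apply/bigmax_ltP; split=> // ij _; rewrite !mxE.
  by rewrite ger0_norm ?divr_ge0 ?(ltW r0)// ltr_pdivrMr// ltr_pMr// ltr1n.
apply: lt_le_trans (enorm_le_diameter Ub (subset_closure Uy) (subset_closure Ux)).
apply: lt_le_trans (normr_coord_le_enorm _ ord0).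
by rewrite !mxE addrAC subrr add0r gtr0_norm divr_gt0.
Qed.

(** The witness is the supremum of the coordinate over the closure; coordinate differences are at
    most Euclidean distances, hence at most the diameter. *)
Lemma coord_range (R : realType) (n : nat) (U : set 'rV[R]_n) (j : 'I_n) :
  U !=set0 -> bounded_set U ->
  exists c, forall x, closure U x -> c - diameter U <= x 0 j <= c.
Proof.
move=> [p Up] Ub; pose S := [set (x : 'rV[R]_n) 0 j | x in closure U].
have le x y : closure U x -> closure U y -> x 0 j <= y 0 j + diameter U.
  move=> Ux Uy; rewrite -lerBlDl; apply: le_trans (enorm_le_diameter Ub Ux Uy).
  by apply: le_trans (normr_coord_le_enorm _ j); rewrite !mxE ler_norm.
exists (sup S) => x Ux; apply/andP; split.
  rewrite lerBlDr; apply: ge_sup; first by exists (p 0 j), p => //; exact: subset_closure.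
  by move=> _ [y Uy <-]; exact: le.
apply: ub_le_sup; last by exists x.
by exists (x 0 j + diameter U) => _ [y Uy <-]; exact: le.
Qed.

(** * Bounds on time slabs and upper limits at infinity *)

Lemma cont_on_slab_bounded (R : realType) (n : nat) (U : set 'rV[R]_n)
    (w : 'rV[R]_n -> R -> R) (s T : R) : bounded_set U -> 0 <= s ->
  cont_on (closure U `*` `[0, +oo[) w ->
  exists M, forall x t, closure U x -> s <= t <= T -> `|w x t| <= M.
Proof.
move=> Ub s0 wc.
have wc' : {within closure U `*` `[s, T], continuous (fun p : 'rV[R]_n * R => w p.1 p.2)}.
  apply: continuous_subspaceW wc => -[x t] [Ux /=]; rewrite in_itv/= => /andP[st _].
  by split => //=; rewrite in_itv/= andbT (le_trans s0).
have [M [_ /(_ (M + 1))]] := compact_bounded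
  (continuous_compact wc' (compact_setX (compact_closure Ub) (@segment_compact R s T))).
rewrite ltrDl => /(_ ltr01) wM; exists (M + 1) => x t Ux st.
by apply: wM; exists (x, t) => //; split => //=; rewrite in_itv.
Qed.

Lemma limf_esup_pinfty_lt (R : realType) (f : R -> R) (l l' : R) :
  limf_esup (fun t => (f t)%:E) +oo%R = l%:E -> l < l' ->
  exists T, forall t, T < t -> f t <= l'.
Proof.
move=> fl ll'; have : (limf_esup (fun t => (f t)%:E) +oo%R < l'%:E)%E by rewrite fl lte_fin.
move=> /ereal_inf_lt[_ [V [T [_ TV]] <-] Vl']; exists T => t Tt.
rewrite -lee_fin; apply: le_trans (ltW Vl').
by apply: ereal_sup_ubound; exists t => //; exact: TV.
Qed.

Lemma limf_esup_pinfty_le0 (R : realType) (f : R -> R) :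
  (forall eps, 0 < eps -> exists T, forall t, T < t -> f t <= eps) ->
  (limf_esup (fun t => (f t)%:E) +oo%R <= 0)%E.
Proof.
move=> fe; apply/lee_addgt0Pr => e e0; rewrite add0e.
have [T fT] := fe e e0.
apply: (@le_trans _ _ (ereal_sup [set (f t)%:E | t in [set t | T < t]])).
  apply: ereal_inf_lbound; exists [set t | T < t] => //.
  by exists T; split => //; exact: num_real.
by apply: ge_ereal_sup => _ [t Tt <-]; rewrite lee_fin fT.
Qed.

(** * Iteration of the one-step estimate *)

Unset Implicit Arguments.

Theorem theorem4p14 (R : realType) (n : nat) (hn : (1 <= n)%N)
  (U : set 'rV[R]_n)
  (U_nonempty : U !=set0) (U_open : open U) (U_bounded : bounded_set U)
  (A : 'rV[R]_n -> R -> 'M[R]_n) (b : 'rV[R]_n -> R -> 'rV[R]_n)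
  (A_sym : forall (x : 'rV[R]_n) (t : R), U x -> 0 < t -> (A x t)^T = A x t)
  (c0 M1 : R) (c0_gt0 : 0 < c0) (M1_gt0 : 0 < M1)
  (A_elliptic : forall (x : 'rV[R]_n) (t : R), U x -> 0 < t -> forall xi : 'rV[R]_n,
     c0 * enorm xi ^+ 2 <= (xi *m A x t *m xi^T) 0 0)
  (A_trace : forall (x : 'rV[R]_n) (t : R), U x -> 0 < t -> \tr (A x t) <= M1)
  (w : 'rV[R]_n -> R -> R)
  (w_cont : cont_on (closure U `*` `[0, +oo[) w)
  (w_C21 : C21 U `]0, +oo[ w)
  (Tstar : R) (Tstar_ge0 : 0 <= Tstar)
  (F : R -> R)
  (F_cont : {within `[Tstar, +oo[, continuous F})
  (F_ge0 : forall t : R, Tstar <= t -> 0 <= F t)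
  (H1 : forall (x : 'rV[R]_n) (t : R), U x -> Tstar < t -> `|Lop A b w x t| <= F t)
  (z0 : R -> R)
  (z0_cont : {within `[Tstar, +oo[, continuous z0})
  (z0_gt0 : forall t : R, Tstar <= t -> 0 < z0 t)
  (z0_incr : increasing_on `[Tstar, +oo[ z0)
  (z0_infty : z0 t @[t --> +oo] --> +oo)
  (H2 : forall (x : 'rV[R]_n) (t : R), U x -> Tstar < t -> enorm (b x t) <= z0 t)
  (Lam : R -> R)
  (Lam_cont : {within `[Tstar, +oo[, continuous Lam})
  (Lam_ge0 : forall t : R, Tstar <= t -> 0 <= Lam t)
  (Lam_decr : decreasing_on `[Tstar, +oo[ Lam)
  (H3 : forall t : R, Tstar <= t ->
     sup [set `|w x tau| | x in boundary U & tau in `[t, t + 1]]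
     + \int[lebesgue_measure]_(tau in `[t, t + 1]) F tau <= Lam t) :
  let d := diameter U in
  let Lambar := fun t : R => Lam (t / 4) in
  forall
  (H4 : (\int[lebesgue_measure]_(x in `[Tstar, +oo[)
           (expR (- (d / c0) * z0 x))%:E)%E = +oo%E)
  (tstar epsstar : R) (tstar_ge : 4 * Tstar <= tstar) (epsstar_gt0 : 0 < epsstar)
  (H5 : forall eps : R, 0 < eps < epsstar ->
     monotone_on `[tstar, +oo[
       (fun t => Lambar t *
          expR (expR (- (d ^+ 2 / (2 * c0)) - eps) *
                \int[lebesgue_measure]_(x in `[tstar, t + 1])
                  expR (- (d / c0) * z0 x))))
  (l : R) (l_ge0 : 0 <= l)
  (H6 : limf_esup (fun t : R => (Lambar t * expR (d / c0 * z0 t))%:E) +oo%R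
        = l%:E),
  (limf_esup (fun t : R => (sup [set `|w x t| | x in closure U])%:E) +oo%R
   <= (expR (d ^+ 2 / (2 * c0)) * l)%:E)%E.
Proof.
move=> d Lambar H4 tstar epsstar _ _ _ l l_ge0 H6.
pose j0 := Ordinal hn.
have d_gt0 : 0 < d by exact: diameter_gt0.
have [c xjc] := coord_range j0 U_nonempty U_bounded.
have [x1 Ux1] := U_nonempty.
have dc0 : 0 < d / c0 by rewrite divr_gt0.
apply: (@le_trans _ _ 0%E); last by rewrite lee_fin mulr_ge0// expR_ge0.
apply: limf_esup_pinfty_le0 => eps' eps'0.
(* The final bound is [2 * eps] from [J k] plus at most [eps / 2] from [2 * Lam (sk k)]. The
   constant [C] bounds [2 * Lam (sk k) / q k], and [N = C / eps] makes [C * q k = theta k * eps],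
   the form that [relaxation_eventually_le] expects. *)
pose eps := eps' / 3; have eps0 : 0 < eps by rewrite divr_gt0.
pose C := 2 * (l + 1).
have C0 : 0 < C by rewrite mulr_gt0// ltr_wpDl.
pose N := C / eps; have N0 : 0 < N by rewrite divr_gt0.
have [T1 LamT] : exists T, forall t, T < t -> Lambar t * expR (d / c0 * z0 t) <= l + 1.
  by apply: limf_esup_pinfty_lt H6 _; rewrite ltrDl.
(* The first threshold yields [2 * theta k <= kappa]; the second yields [theta k <= 1 / 2] through
   [1 + x <= expR x]. *)
have [T2 z0T] : exists T, forall t, T < t ->
    Num.max (4 * N * expR d) (2 * N / (d / c0)) <= z0 t.
  have /cvgryPge/(_ (Num.max (4 * N * expR d) (2 * N / (d / c0)))) := z0_infty.
  by move=> [T [_ TP]]; exists T.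
(* Beyond all thresholds, strictly after [Tstar], and at least 1, so that [4 * sk k >= sk k + 1]. *)
pose s0 := 1 + Tstar + `|T1| + `|T2|.
have s0T : Tstar + 1 <= s0 by rewrite /s0; have := normr_ge0 T1; have := normr_ge0 T2; lra.
have s01 : 1 <= s0 by lra.
have s0T1 : T1 < s0 by rewrite /s0; have := ler_norm T1; have := normr_ge0 T2; lra.
have s0T2 : T2 < s0 by rewrite /s0; have := ler_norm T2; have := normr_ge0 T1; lra.
pose sk (k : nat) := s0 + k%:R.
have skS k : sk k.+1 = sk k + 1 by rewrite /sk -natr1 addrA.
have sk0 k : s0 <= sk k by rewrite /sk lerDl.
have z0_le u v : Tstar <= u -> u <= v -> z0 u <= z0 v.
  by move=> Tu uv; apply: z0_incr => //=; rewrite in_itv/= andbT// (le_trans Tu).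
(* The value at the right end bounds the drift on the whole step, as [z0] increases. *)
pose z k := z0 (sk k + 1).
have zE k : z k = z0 (sk k.+1) by rewrite skS.
pose q k := expR (- (d / c0) * z k).
pose theta k := N * q k.
pose mu k := z k / c0 + 1.
have z_ge k : 4 * N * expR d <= z k /\ 2 * N / (d / c0) <= z k.
  have := z0T (sk k + 1); rewrite ge_max => /(_ _)/andP; apply.
  by have := sk0 k; lra.
have z_ge0 k : 0 <= z k by rewrite ltW// z0_gt0//; have := sk0 k; lra.
have q0 k : 0 < q k by exact: expR_gt0.
have z_mono k : z k <= z k.+1.
  by apply: z0_le; have := sk0 k; rewrite ?skS; lra.
have theta01 k : 0 <= theta k <= 1 / 2.
  rewrite mulr_ge0 ?(ltW N0) ?(ltW (q0 _))//=.
  rewrite /theta /q mulNr expRN ler_pdivrMr ?expR_gt0//.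
  have := (z_ge k).2; rewrite ler_pdivrMr// => zN.
  by have := expR_ge1Dx (d / c0 * z k); lra.
have theta_kappa k : 2 * theta k <= c0 * mu k / 2 * expR (- (mu k * d)).
  have -> : expR (- (mu k * d)) = (expR d)^-1 * q k.
    rewrite -expRN -expRD; congr expR; rewrite /mu; field.
    by rewrite gt_eqF.
  rewrite /theta (mulrA 2 N) (mulrA _ _ (q k)).
  rewrite ler_wpM2r ?(ltW (q0 _))// ler_pdivlMr ?expR_gt0//.
  have -> : c0 * mu k = z k + c0 by rewrite /mu; field; rewrite gt_eqF.
  by have := (z_ge k).1; lra.
have Lam_q k : 2 * Lam (sk k) <= C * q k.
  have := LamT (4 * sk k); rewrite /Lambar [4 * _]mulrC mulfK// => LT.
  have sk4 := sk0 k.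
  have {LT} : Lam (sk k) * expR (d / c0 * z0 (sk k * 4)) <= l + 1 by apply: LT; lra.
  rewrite -ler_pdivlMr ?expR_gt0// -expRN => Lq.
  rewrite /C -mulrA ler_wpM2l//; apply: le_trans Lq _.
  rewrite ler_wpM2l ?ltr_wpDl ?addr_ge0// /q ler_expR mulNr lerN2 ler_wpM2l ?(ltW dc0)//.
  by apply: z0_le; lra.
have s0_ge0 : 0 <= s0 by lra.
have [M0 wM0] := cont_on_slab_bounded s0 U_bounded s0_ge0 w_cont.
(* The initial factor 2 compensates a weight that may be as small as 1/2. *)
pose J := fix J k := if k is k'.+1 then J k' * (1 - theta k') + 2 * Lam (sk k')
  else 2 * `|M0|.
have Lam0 k : 0 <= Lam (sk k) by apply: Lam_ge0; have := sk0 k; lra.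
have J0 k : 0 <= J k.
  elim: k => [|k IH] /=; first by rewrite mulr_ge0.
  by rewrite addr_ge0 ?mulr_ge0// subr_ge0; have := theta01 k; lra.
have mu_ge0 k : 0 <= mu k by rewrite addr_ge0// divr_ge0// ltW.
have xc x : closure U x -> x 0 j0 <= c by move=> /xjc /andP[].
(* Stated at every time of the unit interval: the right end drives the induction, and the times in
   between serve the final estimate. *)
have step k : (forall x, closure U x ->
      `|w x (sk k)| <= J k * exp_barrier (mu k) c (x 0 j0)) ->
    forall x t, closure U x -> sk k <= t <= sk k + 1 ->
    `|w x t| <= (J k * (1 - theta k * (t - sk k)) + 2 * Lam (sk k))
       * exp_barrier (mu k) c (x 0 j0).
  move=> IH x t Ux tst; have skk := sk0 k.
  have [I Ider] := antiderivative_continuous F_cont F_ge0 (ltac:(lra) : Tstar < sk k).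
  have sk_ge0 : 0 <= sk k by lra.
  set S := [set `|w x tau| | x in boundary U & tau in `[sk k, sk k + 1]].
  have [M wM] := cont_on_slab_bounded (sk k + 1) U_bounded sk_ge0 w_cont.
  have wB y u : boundary U y -> sk k <= u <= sk k + 1 -> `|w y u| <= sup S.
    move=> Uy usk; apply: ub_le_sup; last by exists y => //; exists u => //=; rewrite in_itv.
    exists M => _ [y' [Uy' _] [u' u'sk <-]]; rewrite /= in_itv/= in u'sk.
    exact: wM.
  have B0 : 0 <= sup S.
    (* The supremum of the empty set is 0 by convention. *)
    have [->|/set0P[_ [y Uy [u usk _]]]] := eqVneq S set0; first by rewrite sup0.
    by apply: le_trans (wB y u Uy _) => //; move: usk; rewrite /= in_itv.
  have LamBK := H3 (sk k) (ltac:(lra) : Tstar <= sk k).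
  apply: le_trans (@barrier_step R n U A b w F I (sk k) c0 (z k) c d (J k) (sup S)
    (\int[lebesgue_measure]_(tau in `[sk k, sk k + 1]) F tau) (theta k) j0 U_open U_bounded
    sk_ge0 c0_gt0 (z_ge0 k) _ w_C21 xjc _ _ _ _ _ Ider B0 wB (J0 k) (theta01 k)
    (theta_kappa k) IH x t Ux tst) _.
  - apply: continuous_subspaceW w_cont => -[y u] [Uy /=]; rewrite in_itv/= => /andP[su _].
    by split => //=; rewrite in_itv andbT/= (le_trans sk_ge0).
  - by move=> y u Uy su; apply: A_sym => //; lra.
  - by move=> y u Uy su; apply: A_elliptic => //; lra.
  - move=> y u Uy /andP[su us]; apply: le_trans (H2 y u Uy _) _; first by lra.
    by apply: z0_le; lra.
  - by move=> y u Uy /andP[su us]; apply: H1 => //; lra.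
  - by move=> u /andP[su us]; apply: F_ge0; lra.
  - have /andP[h1 _] := exp_barrier_bounds (mu_ge0 k) (xc _ Ux).
    by apply: ler_wpM2r; [rewrite -/(mu k); lra|lra].
have inv k x : closure U x -> `|w x (sk k)| <= J k * exp_barrier (mu k) c (x 0 j0).
  elim: k x => [|k IH] x Ux.
    have /andP[h1 h2] := exp_barrier_bounds (mu_ge0 0) (xc _ Ux).
    rewrite /sk addr0 /=; apply: (@le_trans _ _ `|M0|).
      by apply: le_trans (ler_norm _); apply: wM0 => //; lra.
    by have := normr_ge0 M0; nra.
  rewrite skS; apply: le_trans (step k IH x (sk k + 1) Ux _) _; first by lra.
  have -> : J k * (1 - theta k * (sk k + 1 - sk k)) + 2 * Lam (sk k) = J k.+1.
    by rewrite /= addrAC subrr add0r mulr1.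
  (* Since [mu k <= mu k.+1], the weight of the next step dominates the current one, and no constant
     is lost in the change. *)
  rewrite ler_wpM2l// exp_barrier_mono ?xc// lerD2r ler_wpM2r ?invr_ge0 ?(ltW c0_gt0)//.
have [K JK] : exists K, forall k, (K <= k)%N -> J k <= 2 * eps.
  apply: (relaxation_eventually_le eps0 J0 (theta := theta)) => [k|k|M].
  - by have := theta01 k; lra.
  - have -> : J k.+1 = J k * (1 - theta k) + 2 * Lam (sk k) by [].
    have CN : C = N * eps by rewrite divfK// gt_eqF.
    by have := Lam_q k; rewrite CN /theta; lra.
  (* The base point is [s0 + 1] because [q k] evaluates [z0] at [sk k + 1]; dividing by [N] accounts
     for [theta k = N * q k]. *)
  - have [m qm] : exists m, M / N < \sum_(k < m) expR (- (d / c0) * z0 (s0 + 1 + k%:R)).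
      apply: (sum_unit_steps_unbounded (T := Tstar)
        (g := fun t => expR (- (d / c0) * z0 t))) => //.
      + by lra.
      + move/subspace_continuousP : z0_cont => zc; apply/subspace_continuousP => u Tu.
        have k : (fun=> - (d / c0)) y @[y --> within `[Tstar, +oo[ (nbhs u)] --> - (d / c0).
          exact: cvg_cst.
        exact: (cvg_comp _ _ (cvgM k (zc _ Tu)) (@continuous_expR R _)).
      + by move=> t u Tt tu; rewrite ler_expR !mulNr lerN2 ler_wpM2l ?(ltW dc0)// z0_le.
    exists m; rewrite -mulr_sumr mulrC -ltr_pdivrMr//; apply: lt_le_trans qm _.
    by apply: ler_sum => k _; rewrite /q /z /sk addrAC.
exists (sk K) => t Kt.
apply: ge_sup; first by exists `|w x1 t|, x1 => //; exact: subset_closure.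
move=> _ [x Ux <-].
pose k := Num.truncn (t - s0).
have ts0 : 0 <= t - s0 by have := sk0 K; lra.
have /andP[kt tk] := truncn_itv ts0.
have Kk : (K <= k)%N by rewrite truncn_ge_nat//; rewrite /sk in Kt; lra.
have tsk : sk k <= t <= sk k + 1.
  by rewrite -skS /sk; apply/andP; split; [rewrite /k; lra|rewrite /k; lra].
apply: le_trans (step k (inv k) x t Ux tsk) _.
have /andP[h1 h2] := exp_barrier_bounds (mu_ge0 k) (xc _ Ux).
have Lq := Lam_q k; have th := theta01 k; have Jk := JK k Kk.
have CN : C = N * eps by rewrite divfK// gt_eqF.
have J2 : J k * (1 - theta k * (t - sk k)) <= J k.
  by rewrite ler_piMr// gerBl mulr_ge0//; lra.
have Lk := Lam0 k.
have X0 : 0 <= J k * (1 - theta k * (t - sk k)).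
  by rewrite mulr_ge0// subr_ge0; nra.
apply: (@le_trans _ _ (J k * (1 - theta k * (t - sk k)) + 2 * Lam (sk k))).
  by rewrite ler_piMr//; lra.
have -> : eps' = 3 * eps by rewrite /eps mulrC divfK.
have : C * q k <= eps / 2.
  rewrite CN -/(theta k) mulrAC -/(theta k); nra.
by lra.
Qed.
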